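(* Let $\mathbf{AC^k}$ be the free biassociative intermuting category generated by a set of objects (letters). Then $\mathbf{AC^k}$ is a preorder, i.e. for all objects $A,B$ of $\mathbf{AC^k}$ there is at most one arrow of type $A\to B$.
   Context: A biendofunctor of a category $\mathcal A$ is a functor $\mathcal A\times\mathcal A\to\mathcal A$. A biassociative category $\langle\mathcal A,\wedge,\vee\rangle$ is a category $\mathcal A$ with two biendofunctors $\wedge,\vee$ and natural isomorphisms $\hat b^{\to}_{A,B,C}:A\wedge(B\wedge C)\to(A\wedge B)\wedge C$ and $\check b^{\to}_{A,B,C}:A\vee(B\vee C)\to(A\vee B)\vee C$, with inverses $\hat b^{\leftarrow}_{A,B,C}$, $\check b^{\leftarrow}_{A,B,C}$, each satisfying Mac Lane's pentagonal equation (for $\xi\in\{\wedge,\vee\}$ and $b$ the corresponding $\hat b$ or $\check b$) $$b^{\to}_{A\xi B,C,D}\circ b^{\to}_{A,B,C\xi D}=(b^{\to}_{A,B,C}\,\xi\,\mathbf 1_D)\circ b^{\to}_{A,B\xi C,D}\circ(\mathbf 1_A\,\xi\, b^{\to}_{B,C,D}).$$ A biassociative intermuting category is a biassociative category with a natural transformation $c^k$ (not assumed invertible) with components $c^k_{A,B,C,D}:(A\wedge B)\vee(C\wedge D)\to(A\vee C)\wedge(B\vee D)$ satisfying $$c^k_{A_1\vee A_2,A_1'\vee A_2',A_3,A_3'}\circ(c^k_{A_1,A_1',A_2,A_2'}\vee\mathbf 1_{A_3\wedge A_3'})\circ\check b^{\to}_{A_1\wedge A_1',A_2\wedge A_2',A_3\wedge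 A_3'}=(\check b^{\to}_{A_1,A_2,A_3}\wedge\check b^{\to}_{A_1',A_2',A_3'})\circ c^k_{A_1,A_1',A_2\vee A_3,A_2'\vee A_3'}\circ(\mathbf 1_{A_1\wedge A_1'}\vee c^k_{A_2,A_2',A_3,A_3'}),$$ $$\hat b^{\leftarrow}_{A_1\vee A_1',A_2\vee A_2',A_3\vee A_3'}\circ(c^k_{A_1,A_2,A_1',A_2'}\wedge\mathbf 1_{A_3\vee A_3'})\circ c^k_{A_1\wedge A_2,A_3,A_1'\wedge A_2',A_3'}=(\mathbf 1_{A_1\vee A_1'}\wedge c^k_{A_2,A_3,A_2',A_3'})\circ c^k_{A_1,A_2\wedge A_3,A_1',A_2'\wedge A_3'}\circ(\hat b^{\leftarrow}_{A_1,A_2,A_3}\vee\hat b^{\leftarrow}_{A_1',A_2',A_3'}).$$ The free such category generated by a set of letters: objects are the formulae built from letters by the binary connectives $\wedge,\vee$. Arrow terms are typed expressions generated from $\mathbf 1_A$ and the components, for all formulae as indices, of $\hat b^{\to},\hat b^{\leftarrow},\check b^{\to},\check b^{\leftarrow},c^k$, by composition $\circ$ (when types match) and the operations $\wedge,\vee$. Arrows are equivalence classes of arrow terms under the smallest equivalence relation, congruent with respect to $\circ,\wedge,\vee$, containing the category equations, functoriality of $\wedge,\vee$, the naturality and isomorphism equations, and the equations listed above. *)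

(* Defs.v *)
From Stdlib Require Import FunctionalExtensionality PropExtensionality ProofIrrelevance.

Set Implicit Arguments.
Unset Strict Implicit.
Unset Printing Implicit Defensive.

(** * Biassociative intermuting categories *)

Record Category := {
  Ob :> Type;
  Hom : Ob -> Ob -> Type;
  id : forall A, Hom A A;
  comp : forall A B C, Hom B C -> Hom A B -> Hom A C;
  comp_id_l : forall A B (f : Hom A B), comp (id B) f = f;
  comp_id_r : forall A B (f : Hom A B), comp f (id A) = f;
  comp_assoc : forall A B C D (h : Hom C D) (g : Hom B C) (f : Hom A B),
      comp h (comp g f) = comp (comp h g) f
}.
Arguments Hom {_} _ _.
Arguments id {_} _.
Arguments comp {_ _ _ _} _ _.

(** A category is called a preorder when it is thin. *)
Definition is_preorder (C : Category) : Prop :=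
  forall (A B : C) (f g : Hom A B), f = g.

Declare Scope cat_scope.
Delimit Scope cat_scope with cat.
Local Open Scope cat_scope.
Notation "g \o f" := (comp g f) (at level 50, left associativity) : cat_scope.

Record Biendofunctor (C : Category) := {
  bob :> C -> C -> C;
  bar : forall A A' B B' : C, Hom A A' -> Hom B B' -> Hom (bob A B) (bob A' B');
  bar_id : forall A B : C, bar (id A) (id B) = id (bob A B);
  bar_comp : forall (A A' A'' B B' B'' : C)
      (f' : Hom A' A'') (f : Hom A A') (g' : Hom B' B'') (g : Hom B B'),
      bar (f' \o f) (g' \o g) = bar f' g' \o bar f g
}.
Arguments bar {_} _ {_ _ _ _} _ _.

(** [b_natural] is stated for [b_to] only; naturality of the inverse follows. *)
Record Associativity (C : Category) (X : Biendofunctor C) := {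
  b_to : forall A B D : C, Hom (X A (X B D)) (X (X A B) D);
  b_from : forall A B D : C, Hom (X (X A B) D) (X A (X B D));
  b_to_from : forall A B D, b_to A B D \o b_from A B D = id _;
  b_from_to : forall A B D, b_from A B D \o b_to A B D = id _;
  b_natural : forall (A A' B B' D D' : C)
      (f : Hom A A') (g : Hom B B') (h : Hom D D'),
      bar X (bar X f g) h \o b_to A B D = b_to A' B' D' \o bar X f (bar X g h);
  b_pentagon : forall A B D E : C,
      b_to (X A B) D E \o b_to A B (X D E)
      = bar X (b_to A B D) (id E) \o b_to A (X B D) E \o bar X (id A) (b_to B D E)
}.
Arguments b_to {_ _} _ _ _ _.
Arguments b_from {_ _} _ _ _ _.

Record BiassociativeCategory := {
  ba_cat :> Category;
  meet : Biendofunctor ba_cat;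
  join : Biendofunctor ba_cat;
  bhat : Associativity meet;
  bcheck : Associativity join
}.
Arguments meet {_}.
Arguments join {_}.
Arguments bhat {_}.
Arguments bcheck {_}.

Record BiassociativeIntermutingCategory := {
  bi_cat :> BiassociativeCategory;
  ck : forall A B C D : bi_cat,
      Hom (join (meet A B) (meet C D)) (meet (join A C) (join B D));
  ck_natural : forall (A A' B B' C C' D D' : bi_cat)
      (f : Hom A A') (g : Hom B B') (h : Hom C C') (i : Hom D D'),
      bar meet (bar join f h) (bar join g i) \o ck A B C D
      = ck A' B' C' D' \o bar join (bar meet f g) (bar meet h i);
  ck_bcheck : forall A1 A1' A2 A2' A3 A3' : bi_cat,
      ck (join A1 A2) (join A1' A2') A3 A3'
        \o bar join (ck A1 A1' A2 A2') (id (meet A3 A3'))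
        \o b_to bcheck (meet A1 A1') (meet A2 A2') (meet A3 A3')
      = bar meet (b_to bcheck A1 A2 A3) (b_to bcheck A1' A2' A3')
        \o ck A1 A1' (join A2 A3) (join A2' A3')
        \o bar join (id (meet A1 A1')) (ck A2 A2' A3 A3');
  ck_bhat : forall A1 A1' A2 A2' A3 A3' : bi_cat,
      b_from bhat (join A1 A1') (join A2 A2') (join A3 A3')
        \o bar meet (ck A1 A2 A1' A2') (id (join A3 A3'))
        \o ck (meet A1 A2) A3 (meet A1' A2') A3'
      = bar meet (id (join A1 A1')) (ck A2 A3 A2' A3')
        \o ck A1 (meet A2 A3) A1' (meet A2' A3')
        \o bar join (b_from bhat A1 A2 A3) (b_from bhat A1' A2' A3')
}.

(** * The free biassociative intermuting category *)

Inductive connective : Set := And | Or.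

Inductive formula (L : Type) : Type :=
| Letter : L -> formula L
| Bin : connective -> formula L -> formula L -> formula L.

Declare Scope formula_scope.
Delimit Scope formula_scope with F.
Bind Scope formula_scope with formula.
Local Open Scope formula_scope.
Notation "A /\ B" := (Bin And A B) : formula_scope.
Notation "A \/ B" := (Bin Or A B) : formula_scope.

Inductive term (L : Type) : formula L -> formula L -> Type :=
| t_id : forall A, term A A
| t_comp : forall A B C, term B C -> term A B -> term A C
| t_bin : forall (x : connective) A A' B B',
    term A A' -> term B B' -> term (Bin x A B) (Bin x A' B')
| t_b_to : forall (x : connective) A B C,
    term (Bin x A (Bin x B C)) (Bin x (Bin x A B) C)
| t_b_from : forall (x : connective) A B C,
    term (Bin x (Bin x A B) C) (Bin x A (Bin x B C))
| t_ck : forall A B C D,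
    term ((A /\ B) \/ (C /\ D)) ((A \/ C) /\ (B \/ D)).

Declare Scope term_scope.
Delimit Scope term_scope with T.
Bind Scope term_scope with term.
Notation "g \o f" := (t_comp g f) (at level 50, left associativity) : term_scope.

Reserved Notation "f == g" (at level 70, no associativity).

Inductive term_eq (L : Type) : forall A B : formula L, term A B -> term A B -> Prop :=
| te_refl : forall A B (f : term A B), f == f
| te_sym : forall A B (f g : term A B), f == g -> g == f
| te_trans : forall A B (f g h : term A B), f == g -> g == h -> f == h
| te_comp : forall A B C (g g' : term B C) (f f' : term A B),
    g == g' -> f == f' -> g \o f == g' \o f'
| te_bin : forall x A A' B B' (f f' : term A A') (g g' : term B B'),
    f == f' -> g == g' -> t_bin x f g == t_bin x f' g'
| te_id_l : forall A B (f : term A B), t_id B \o f == f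
| te_id_r : forall A B (f : term A B), f \o t_id A == f
| te_assoc : forall A B C D (h : term C D) (g : term B C) (f : term A B),
    h \o (g \o f) == (h \o g) \o f
| te_bin_id : forall x A B, t_bin x (t_id A) (t_id B) == t_id (Bin x A B)
| te_bin_comp : forall x A A' A'' B B' B''
    (f' : term A' A'') (f : term A A') (g' : term B' B'') (g : term B B'),
    t_bin x (f' \o f) (g' \o g) == t_bin x f' g' \o t_bin x f g
| te_b_to_from : forall x A B C, t_b_to x A B C \o t_b_from x A B C == t_id _
| te_b_from_to : forall x A B C, t_b_from x A B C \o t_b_to x A B C == t_id _
| te_b_natural : forall x A A' B B' C C'
    (f : term A A') (g : term B B') (h : term C C'),
    t_bin x (t_bin x f g) h \o t_b_to x A B C
    == t_b_to x A' B' C' \o t_bin x f (t_bin x g h)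
| te_b_pentagon : forall x A B C D,
    t_b_to x (Bin x A B) C D \o t_b_to x A B (Bin x C D)
    == t_bin x (t_b_to x A B C) (t_id D)
       \o t_b_to x A (Bin x B C) D
       \o t_bin x (t_id A) (t_b_to x B C D)
| te_ck_natural : forall A A' B B' C C' D D'
    (f : term A A') (g : term B B') (h : term C C') (i : term D D'),
    t_bin And (t_bin Or f h) (t_bin Or g i) \o t_ck A B C D
    == t_ck A' B' C' D' \o t_bin Or (t_bin And f g) (t_bin And h i)
| te_ck_bcheck : forall A1 A1' A2 A2' A3 A3',
    t_ck (A1 \/ A2) (A1' \/ A2') A3 A3'
      \o t_bin Or (t_ck A1 A1' A2 A2') (t_id (A3 /\ A3'))
      \o t_b_to Or (A1 /\ A1') (A2 /\ A2') (A3 /\ A3')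
    == t_bin And (t_b_to Or A1 A2 A3) (t_b_to Or A1' A2' A3')
      \o t_ck A1 A1' (A2 \/ A3) (A2' \/ A3')
      \o t_bin Or (t_id (A1 /\ A1')) (t_ck A2 A2' A3 A3')
| te_ck_bhat : forall A1 A1' A2 A2' A3 A3',
    t_b_from And (A1 \/ A1') (A2 \/ A2') (A3 \/ A3')
      \o t_bin And (t_ck A1 A2 A1' A2') (t_id (A3 \/ A3'))
      \o t_ck (A1 /\ A2) A3 (A1' /\ A2') A3'
    == t_bin And (t_id (A1 \/ A1')) (t_ck A2 A3 A2' A3')
      \o t_ck A1 (A2 /\ A3) A1' (A2' /\ A3')
      \o t_bin Or (t_b_from And A1 A2 A3) (t_b_from And A1' A2' A3')
where "f == g" := (@term_eq _ _ _ f%T g%T).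

(** Arrows are the equivalence classes of [term_eq], as predicates on terms. *)
Definition arrow (L : Type) (A B : formula L) : Type :=
  { P : term A B -> Prop | exists f, P = term_eq f }.

Definition cls (L : Type) (A B : formula L) (f : term A B) : arrow A B :=
  exist _ (term_eq f) (ex_intro _ f eq_refl).

Lemma cls_eq (L : Type) (A B : formula L) (f g : term A B) :
  cls f = cls g <-> f == g.
Proof.
split.
- intro E. apply (f_equal (@proj1_sig _ _)) in E. simpl in E.
  rewrite E. apply te_refl.
- intro E. apply subset_eq_compat.
  apply functional_extensionality; intro h.
  apply propositional_extensionality; split; intro H.
  + exact (te_trans (te_sym E) H).
  + exact (te_trans E H).
Qed.

Lemma cls_surj (L : Type) (A B : formula L) (a : arrow A B) :
  exists f, a = cls f.
Proof.
destruct a as [P [f E]]. exists f. now apply subset_eq_compat.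
Qed.

Section Lift2.
Variables (L : Type) (A B C D E F : formula L).
Variable op : term A B -> term C D -> term E F.
Hypothesis op_congr :
  forall f f' g g', f == f' -> g == g' -> op f g == op f' g'.

Lemma lift2_class (a : arrow A B) (b : arrow C D) :
  exists h, (fun k => exists f g, proj1_sig a f /\ proj1_sig b g /\ op f g == k)%type
            = term_eq h.
Proof.
destruct a as [P [f ->]], b as [Q [g ->]]. exists (op f g). simpl.
apply functional_extensionality; intro k.
apply propositional_extensionality; split.
- intros (f' & g' & Hf & Hg & H). exact (te_trans (op_congr Hf Hg) H).
- intro H. exists f, g. repeat split; trivial; apply te_refl.
Qed.

(** The class of all terms equal to [op f g] for [f] in [a] and [g] in [b]. *)
Definition lift2 (a : arrow A B) (b : arrow C D) : arrow E F :=
  exist _ _ (lift2_class a b).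

Lemma lift2_cls f g : lift2 (cls f) (cls g) = cls (op f g).
Proof.
apply subset_eq_compat. simpl.
apply functional_extensionality; intro k.
apply propositional_extensionality; split.
- intros (f' & g' & Hf & Hg & H). exact (te_trans (op_congr Hf Hg) H).
- intro H. exists f, g. repeat split; trivial; apply te_refl.
Qed.
End Lift2.

Definition arrow_comp (L : Type) (A B C : formula L) :
  arrow B C -> arrow A B -> arrow A C := lift2 (@te_comp L A B C).

Definition arrow_bin (L : Type) (x : connective) (A A' B B' : formula L) :
  arrow A A' -> arrow B B' -> arrow (Bin x A B) (Bin x A' B') :=
  lift2 (@te_bin L x A A' B B').

Ltac reps :=
  repeat match goal with
  | a : arrow _ _ |- _ =>
      let f := fresh "f" in destruct (cls_surj a) as [f ->]
  end;
  unfold arrow_comp, arrow_bin; rewrite ?lift2_cls; apply cls_eq.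

Program Definition ACk_cat (L : Type) : Category := {|
  Ob := formula L;
  Hom := @arrow L;
  id := fun A => cls (t_id A);
  comp := @arrow_comp L
|}.
Next Obligation. reps. apply te_id_l. Qed.
Next Obligation. reps. apply te_id_r. Qed.
Next Obligation. reps. apply te_assoc. Qed.

Program Definition ACk_bin (L : Type) (x : connective) : Biendofunctor (ACk_cat L) := {|
  bob := (@Bin L x : ACk_cat L -> ACk_cat L -> ACk_cat L);
  bar := @arrow_bin L x
|}.
Next Obligation. reps. apply te_bin_id. Qed.
Next Obligation. reps. apply te_bin_comp. Qed.

Program Definition ACk_assoc (L : Type) (x : connective) : Associativity (ACk_bin L x) := {|
  b_to := fun A B C => cls (t_b_to x A B C);
  b_from := fun A B C => cls (t_b_from x A B C)
|}.
Next Obligation. reps. apply te_b_to_from. Qed.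
Next Obligation. reps. apply te_b_from_to. Qed.
Next Obligation. reps. apply te_b_natural. Qed.
Next Obligation. reps. apply te_b_pentagon. Qed.

Definition ACk_biassociative (L : Type) : BiassociativeCategory := {|
  ba_cat := ACk_cat L;
  meet := ACk_bin L And;
  join := ACk_bin L Or;
  bhat := ACk_assoc L And;
  bcheck := ACk_assoc L Or
|}.

Program Definition ACk (L : Type) : BiassociativeIntermutingCategory := {|
  bi_cat := ACk_biassociative L;
  ck := fun A B C D => cls (t_ck A B C D)
|}.
Next Obligation. reps. apply te_ck_natural. Qed.
Next Obligation. reps. apply te_ck_bcheck. Qed.
Next Obligation. reps. apply te_ck_bhat. Qed.

(* Main.v *)
From Stdlib Require Import Setoid Morphisms Lia ProofIrrelevance.
Require Import Defs.

Set Implicit Arguments.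
Unset Strict Implicit.
Unset Printing Implicit Defensive.

(** An arrow out of [A x B] factors as [glue s o (f1 x f2)], where [s] cuts the
target into a left and a right part, glued together by a canonical arrow: a cut
along [x], or, for disjunctions, a cut passing through conjunctions by
intermutation.  By induction on the source, such an arrow is unique as soon as
[s] is determined by the source and the target.  For conjunctions [s] is read
off from the breadth, an arithmetical invariant of arrows.  For disjunctions,
one shows that [A] has arrows into the left part of at most one split of a
given formula: if [A] is a disjunction, its first disjunct determines a split,
and its second one determines a split of the remainder; if [A] is a
conjunction, it cuts the left part, and the breadth shows that the two halves
are parts of formulae that depend on the target only. *)

Local Open Scope term_scope.

(** * Rewriting modulo equality of arrow terms *)

#[local] Instance term_eq_equivalence (L : Type) (A B : formula L) :
  Equivalence (@term_eq L A B).
Proof.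
split; [exact (@te_refl L A B) | exact (@te_sym L A B) | exact (@te_trans L A B)].
Qed.

#[local] Instance t_comp_proper (L : Type) (A B C : formula L) :
  Proper (@term_eq L B C ==> @term_eq L A B ==> @term_eq L A C) (@t_comp L A B C).
Proof. intros g g' Hg f f' Hf. now apply te_comp. Qed.

#[local] Instance t_bin_proper (L : Type) x (A A' B B' : formula L) :
  Proper (@term_eq L A A' ==> @term_eq L B B' ==> @term_eq L _ _)
    (@t_bin L x A A' B B').
Proof. intros f f' Hf g g' Hg. now apply te_bin. Qed.

Section Calculus.
Variable L : Type.
Implicit Types A B C D P Q : formula L.

(** * Consequences of the coherence equations *)

Lemma bin_comp_l x A A' A'' B B' (f' : term A' A'') (f : term A A') (g : term B B') :
  t_bin x (f' \o f) g == t_bin x f' (t_id B') \o t_bin x f g.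
Proof. rewrite <- te_bin_comp, te_id_l. reflexivity. Qed.

Lemma bin_comp_r x A A' B B' B'' (f : term A A') (g' : term B' B'') (g : term B B') :
  t_bin x f (g' \o g) == t_bin x (t_id A') g' \o t_bin x f g.
Proof. rewrite <- te_bin_comp, te_id_l. reflexivity. Qed.

Lemma b_from_natural x A A' B B' C C'
    (f : term A A') (g : term B B') (h : term C C') :
  t_bin x f (t_bin x g h) \o t_b_from x A B C
  == t_b_from x A' B' C' \o t_bin x (t_bin x f g) h.
Proof.
rewrite <- (te_id_l (_ \o t_b_from x A B C)), <- te_b_from_to.
rewrite <- te_assoc, (te_assoc (t_b_to _ _ _ _)), <- te_b_natural.
rewrite <- te_assoc, te_b_to_from, te_id_r. reflexivity.
Qed.

Lemma move_inv_l A B C (a : term B C) (a' : term C B) (f : term A B) (g : term A C) :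
  a' \o a == t_id B -> a \o f == g -> f == a' \o g.
Proof. intros H <-. rewrite te_assoc, H, te_id_l. reflexivity. Qed.

Lemma move_inv_r A B C (a : term A B) (a' : term B A) (f : term B C) (g : term A C) :
  a \o a' == t_id B -> f \o a == g -> f == g \o a'.
Proof. intros H <-. rewrite <- te_assoc, H, te_id_r. reflexivity. Qed.

Lemma bin_inverse x A A' B B' (f : term A A') (f' : term A' A) (g : term B B')
    (g' : term B' B) :
  f' \o f == t_id A -> g' \o g == t_id B ->
  t_bin x f' g' \o t_bin x f g == t_id _.
Proof. intros Hf Hg. rewrite <- te_bin_comp, Hf, Hg. apply te_bin_id. Qed.

(** This and [b_pentagon_right] are the pentagon with some of its sides inverted, in the forms met
    when a split inside the second or third of three factors is carried across [t_b_to]. *)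
Lemma b_pentagon_middle x A B C D :
  t_b_to x A (Bin x B C) D \o t_bin x (t_id A) (t_b_to x B C D) \o t_b_from x A B (Bin x C D)
  == t_bin x (t_b_from x A B C) (t_id D) \o t_b_to x (Bin x A B) C D.
Proof.
symmetry. apply move_inv_r with (1 := te_b_to_from _ _ _ _).
rewrite <- te_assoc. symmetry.
apply move_inv_l with (a := t_bin x (t_b_to x A B C) (t_id D)).
- apply bin_inverse; [apply te_b_from_to | apply te_id_l].
- rewrite te_assoc. symmetry. apply te_b_pentagon.
Qed.

Lemma b_pentagon_right x A B C D :
  t_b_to x A B (Bin x C D) \o t_bin x (t_id A) (t_b_from x B C D) \o t_b_from x A (Bin x B C) D
  == t_b_from x (Bin x A B) C D \o t_bin x (t_b_to x A B C) (t_id D).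
Proof.
apply move_inv_l with (1 := te_b_from_to _ _ _ _).
rewrite !te_assoc, te_b_pentagon.
rewrite <- (te_assoc _ (t_bin x _ (t_b_to _ _ _ _))), bin_inverse
  by (apply te_b_to_from || apply te_id_l).
rewrite te_id_r, <- te_assoc, te_b_to_from, te_id_r. reflexivity.
Qed.

Lemma ck_bcheck_from A1 A1' A2 A2' A3 A3' :
  t_ck A1 A1' (A2 \/ A3) (A2' \/ A3')
    \o t_bin Or (t_id (A1 /\ A1')) (t_ck A2 A2' A3 A3')
    \o t_b_from Or (A1 /\ A1') (A2 /\ A2') (A3 /\ A3')
  == t_bin And (t_b_from Or A1 A2 A3) (t_b_from Or A1' A2' A3')
    \o t_ck (A1 \/ A2) (A1' \/ A2') A3 A3'
    \o t_bin Or (t_ck A1 A1' A2 A2') (t_id (A3 /\ A3')).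
Proof.
symmetry. apply move_inv_r with (1 := te_b_to_from _ _ _ _).
rewrite <- !te_assoc. symmetry.
apply move_inv_l with (a := t_bin And (t_b_to Or A1 A2 A3) (t_b_to Or A1' A2' A3')).
- apply bin_inverse; apply te_b_from_to.
- rewrite !te_assoc. symmetry. apply te_ck_bcheck.
Qed.

(** * Splits and their gluing arrows *)

(** A split [s] of [B] along [x] labels the letters of [B] with left and right,
in such a way that [B] can be reached from [Bin x (lft s) (rgt s)]; at a
conjunction split along [Or], both conjuncts must contain both labels. *)
Fixpoint split (x : connective) (B : formula L) : Type :=
  match B with
  | Letter _ => Empty_set
  | Bin y B1 B2 =>
      match x, y with
      | Or, Or | And, And => unit + (split x B1 + split x B2)
      | Or, And => split x B1 * split x B2
      | And, Or => Empty_set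
      end
  end%type.

Fixpoint lft x B : split x B -> formula L :=
  match B with
  | Letter _ => fun s => match s with end
  | Bin y B1 B2 =>
      match x, y return split x (Bin y B1 B2) -> formula L with
      | Or, Or => fun s =>
          match s with
          | inl _ => B1
          | inr (inl s1) => lft s1
          | inr (inr s2) => (B1 \/ lft s2)%F
          end
      | And, And => fun s =>
          match s with
          | inl _ => B1
          | inr (inl s1) => lft s1
          | inr (inr s2) => (B1 /\ lft s2)%F
          end
      | Or, And => fun s => (lft (fst s) /\ lft (snd s))%F
      | And, Or => fun s => match s with end
      end
  end.

Fixpoint rgt x B : split x B -> formula L :=
  match B with
  | Letter _ => fun s => match s with end
  | Bin y B1 B2 =>
      match x, y return split x (Bin y B1 B2) -> formula L with
      | Or, Or => fun s =>
          match s with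
          | inl _ => B2
          | inr (inl s1) => (rgt s1 \/ B2)%F
          | inr (inr s2) => rgt s2
          end
      | And, And => fun s =>
          match s with
          | inl _ => B2
          | inr (inl s1) => (rgt s1 /\ B2)%F
          | inr (inr s2) => rgt s2
          end
      | Or, And => fun s => (rgt (fst s) /\ rgt (snd s))%F
      | And, Or => fun s => match s with end
      end
  end.

Definition glue_l x P Q A (B : formula L) (e : term (Bin x P Q) A) :
  term (Bin x P (Bin x Q B)) (Bin x A B) :=
  t_bin x e (t_id B) \o t_b_to x P Q B.

Definition glue_r x P Q (A : formula L) B (e : term (Bin x P Q) B) :
  term (Bin x (Bin x A P) Q) (Bin x A B) :=
  t_bin x (t_id A) e \o t_b_from x A P Q.

Definition glue_and P Q P' Q' A B (e : term (P \/ Q) A) (e' : term (P' \/ Q') B) :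
  term ((P /\ P') \/ (Q /\ Q')) (A /\ B) :=
  t_bin And e e' \o t_ck P P' Q Q'.

Fixpoint glue x B : forall s : split x B, term (Bin x (lft s) (rgt s)) B :=
  match B with
  | Letter _ => fun s => match s with end
  | Bin y B1 B2 =>
      match x, y return
        forall s : split x (Bin y B1 B2), term (Bin x (lft s) (rgt s)) (Bin y B1 B2)
      with
      | Or, Or => fun s =>
          match s with
          | inl _ => t_id _
          | inr (inl s1) => glue_l B2 (glue s1)
          | inr (inr s2) => glue_r B1 (glue s2)
          end
      | And, And => fun s =>
          match s with
          | inl _ => t_id _
          | inr (inl s1) => glue_l B2 (glue s1)
          | inr (inr s2) => glue_r B1 (glue s2)
          end
      | Or, And => fun s => glue_and (glue (fst s)) (glue (snd s))
      | And, Or => fun s => match s with end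
      end
  end.

(** * Gluing against the structural arrows *)

Lemma glue_l_natural x P Q A P' Q' A' B B' (e : term (Bin x P Q) A)
    (e' : term (Bin x P' Q') A') f1 f2 f (g : term B B') :
  f \o e == e' \o t_bin x f1 f2 ->
  t_bin x f g \o glue_l B e == glue_l B' e' \o t_bin x f1 (t_bin x f2 g).
Proof.
intro H. unfold glue_l.
rewrite te_assoc, <- te_bin_comp, H, te_id_r, <- (te_id_l g) at 1.
rewrite te_bin_comp, <- !te_assoc, te_b_natural. reflexivity.
Qed.

Lemma glue_r_natural x P Q A P' Q' A' B B' (e : term (Bin x P Q) B)
    (e' : term (Bin x P' Q') B') (g : term A A') f1 f2 f :
  f \o e == e' \o t_bin x f1 f2 ->
  t_bin x g f \o glue_r A e == glue_r A' e' \o t_bin x (t_bin x g f1) f2.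
Proof.
intro H. unfold glue_r.
rewrite te_assoc, <- te_bin_comp, H, te_id_r, <- (te_id_l g) at 1.
rewrite te_bin_comp, <- !te_assoc, b_from_natural. reflexivity.
Qed.

Lemma glue_and_natural P Q A P' Q' A' R S B R' S' B'
    (e : term (P \/ Q) A) (e' : term (P' \/ Q') A')
    (d : term (R \/ S) B) (d' : term (R' \/ S') B') f f1 f2 g g1 g2 :
  f \o e == e' \o t_bin Or f1 f2 -> g \o d == d' \o t_bin Or g1 g2 ->
  t_bin And f g \o glue_and e d
  == glue_and e' d' \o t_bin Or (t_bin And f1 g1) (t_bin And f2 g2).
Proof.
intros Hf Hg. unfold glue_and.
rewrite te_assoc, <- te_bin_comp, Hf, Hg, te_bin_comp, <- !te_assoc, te_ck_natural.
reflexivity.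
Qed.

Lemma b_to_glue_l_top x A B C :
  t_b_to x A B C == glue_l C (t_id (Bin x A B)).
Proof. unfold glue_l. rewrite te_bin_id, te_id_l. reflexivity. Qed.

Lemma b_to_glue_r_top x A B C :
  t_b_to x A B C \o glue_r A (t_id (Bin x B C)) == t_id _.
Proof. unfold glue_r. rewrite te_bin_id, te_id_l. apply te_b_to_from. Qed.

Lemma b_to_glue_l x P Q A B C (e : term (Bin x P Q) A) :
  t_b_to x A B C \o glue_l (Bin x B C) e
  == glue_l C (glue_l B e) \o t_bin x (t_id P) (t_b_to x Q B C).
Proof.
unfold glue_l. rewrite <- (te_bin_id x B C).
rewrite te_assoc, <- te_b_natural, <- te_assoc, te_b_pentagon.
rewrite bin_comp_l, !te_assoc. reflexivity.
Qed.

Lemma b_to_glue_r_l x P Q A B C (e : term (Bin x P Q) B) :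
  t_b_to x A B C \o glue_r A (glue_l C e) == glue_l C (glue_r A e).
Proof.
unfold glue_r, glue_l.
rewrite bin_comp_r, <- te_assoc, te_assoc, <- te_b_natural.
rewrite bin_comp_l, <- !te_assoc. apply te_comp; [reflexivity|].
rewrite te_assoc. apply b_pentagon_middle.
Qed.

Lemma b_to_glue_r_r x P Q A B C (e : term (Bin x P Q) C) :
  t_b_to x A B C \o glue_r A (glue_r B e)
  == glue_r (Bin x A B) e \o t_bin x (t_b_to x A B P) (t_id Q).
Proof.
unfold glue_r.
rewrite bin_comp_r, <- te_assoc, te_assoc, <- te_b_natural, te_bin_id.
rewrite <- !te_assoc. apply te_comp; [reflexivity|].
rewrite te_assoc. apply b_pentagon_right.
Qed.

(** For identities [a], [b], [c] this is, up to units, the coherence equation between intermutation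
    and associativity of conjunction; naturality gives the general case. *)
Lemma b_from_glue_and P Q A P' Q' B P'' Q'' C
    (a : term (P \/ Q) A) (b : term (P' \/ Q') B) (c : term (P'' \/ Q'') C) :
  t_b_from And A B C \o glue_and (glue_and a b) c
  == glue_and a (glue_and b c) \o t_bin Or (t_b_from And P P' P'') (t_b_from And Q Q' Q'').
Proof.
unfold glue_and.
rewrite <- (te_id_r c) at 1. rewrite <- (te_id_r a) at 2.
rewrite !te_bin_comp, <- !te_assoc, (te_assoc (t_b_from _ _ _ _)).
rewrite <- b_from_natural, <- !te_assoc. apply te_comp; [reflexivity|].
rewrite !te_assoc. apply te_ck_bhat.
Qed.

Lemma b_to_glue_and P Q A P' Q' B P'' Q'' C
    (a : term (P \/ Q) A) (b : term (P' \/ Q') B) (c : term (P'' \/ Q'') C) :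
  t_b_to And A B C \o glue_and a (glue_and b c)
  == glue_and (glue_and a b) c \o t_bin Or (t_b_to And P P' P'') (t_b_to And Q Q' Q'').
Proof.
apply move_inv_r with (a := t_bin Or (t_b_from And P P' P'') (t_b_from And Q Q' Q'')).
- apply bin_inverse; apply te_b_from_to.
- rewrite <- te_assoc. symmetry. apply move_inv_l with (1 := te_b_to_from _ _ _ _).
  apply b_from_glue_and.
Qed.

Lemma ck_glue_top A B C D :
  t_ck A B C D == glue_and (t_id (A \/ C)) (t_id (B \/ D)).
Proof. unfold glue_and. rewrite te_bin_id, te_id_l. reflexivity. Qed.

(** In the same way, this is the coherence equation between intermutation and associativity of
    disjunction, extended by naturality; [ck_glue_r] extends its form with inverses. *)
Lemma ck_glue_l P Q A P' Q' B C D (a : term (P \/ Q) A) (b : term (P' \/ Q') B) :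
  t_ck A B C D \o glue_l (C /\ D) (glue_and a b)
  == glue_and (glue_l C a) (glue_l D b) \o t_bin Or (t_id (P /\ P')) (t_ck Q Q' C D).
Proof.
unfold glue_l, glue_and.
rewrite bin_comp_l, te_bin_comp, <- (te_bin_id And C D) at 1.
rewrite !te_assoc, <- te_ck_natural.
rewrite <- !te_assoc. apply te_comp; [reflexivity|].
rewrite !te_assoc. apply te_ck_bcheck.
Qed.

Lemma ck_glue_r P Q C P' Q' D A B (c : term (P \/ Q) C) (d : term (P' \/ Q') D) :
  t_ck A B C D \o glue_r (A /\ B) (glue_and c d)
  == glue_and (glue_r A c) (glue_r B d) \o t_bin Or (t_ck A B P P') (t_id (Q /\ Q')).
Proof.
unfold glue_r, glue_and.
rewrite bin_comp_r, te_bin_comp, <- (te_bin_id And A B) at 1.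
rewrite !te_assoc, <- te_ck_natural.
rewrite <- !te_assoc. apply te_comp; [reflexivity|].
rewrite !te_assoc. apply ck_bcheck_from.
Qed.

(** * Transport of splits along arrows *)

(** Splits are transported from source to target only: a cut of the target of an intermutation, for
    instance, has no counterpart in the source, which is a disjunction. *)
Definition slides x A B (f : term A B) (s : split x A) (s' : split x B) : Prop :=
  exists (f1 : term (lft s) (lft s')) (f2 : term (rgt s) (rgt s')),
    f \o glue s == glue s' \o t_bin x f1 f2.

Definition b_slides x y A B C (s : split y (Bin x A (Bin x B C)))
    (s' : split y (Bin x (Bin x A B) C)) : Prop :=
  (slides (t_b_to x A B C) s s' /\ slides (t_b_from x A B C) s' s)%type.

Lemma b_slides_intro x y A B C (s : split y (Bin x A (Bin x B C)))
    (s' : split y (Bin x (Bin x A B) C))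
    (f1 : term (lft s) (lft s')) (f1' : term (lft s') (lft s))
    (f2 : term (rgt s) (rgt s')) (f2' : term (rgt s') (rgt s)) :
  f1 \o f1' == t_id _ -> f2 \o f2' == t_id _ ->
  t_b_to x A B C \o glue s == glue s' \o t_bin y f1 f2 -> b_slides s s'.
Proof.
intros H1 H2 H. split; [now exists f1, f2|]. exists f1', f2'.
symmetry. apply move_inv_l with (1 := te_b_from_to _ _ _ _).
rewrite te_assoc, H, <- te_assoc, bin_inverse by assumption. apply te_id_r.
Qed.

Tactic Notation "b_slides_by" uconstr(f1) uconstr(f1') uconstr(f2) uconstr(f2') uconstr(eqn) :=
  lazymatch goal with |- @b_slides ?x ?y ?A ?B ?C ?s ?s' =>
    apply (@b_slides_intro x y A B C s s' f1 f1' f2 f2') end;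
  [ first [apply te_b_to_from | apply te_id_l]
  | first [apply te_b_to_from | apply te_id_l]
  | simpl; rewrite ?te_bin_id, ?te_id_r; apply eqn ].

(** Along its own connective, a product of three factors is split between two neighbours or inside
    one factor, which makes five cases. Along [Or], a conjunction is split in all three factors at
    once; along [And], a disjunction has no split. *)
Lemma b_slides_total x y A B C :
  (forall s : split y (Bin x A (Bin x B C)), exists s', b_slides s s') /\
  (forall s' : split y (Bin x (Bin x A B) C), exists s, b_slides s s').
Proof.
split; intro s; destruct y, x.
- destruct s as [[]|[a|[[]|[b|c]]]].
  + exists (inr (inl (inl tt))).
    b_slides_by (t_id _) (t_id _) (t_id _) (t_id _) b_to_glue_l_top.
  + exists (inr (inl (inr (inl a)))).
    b_slides_by (t_id _) (t_id _) (t_b_to _ _ _ _) (t_b_from _ _ _ _) b_to_glue_l.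
  + exists (inl tt). b_slides_by (t_id _) (t_id _) (t_id _) (t_id _) b_to_glue_r_top.
  + exists (inr (inl (inr (inr b)))).
    b_slides_by (t_id _) (t_id _) (t_id _) (t_id _) b_to_glue_r_l.
  + exists (inr (inr c)).
    b_slides_by (t_b_to _ _ _ _) (t_b_from _ _ _ _) (t_id _) (t_id _) b_to_glue_r_r.
- destruct s.
- destruct s as [a [b c]]. exists ((a, b), c).
  b_slides_by (t_b_to _ _ _ _) (t_b_from _ _ _ _) (t_b_to _ _ _ _) (t_b_from _ _ _ _) b_to_glue_and.
- destruct s as [[]|[a|[[]|[b|c]]]].
  + exists (inr (inl (inl tt))).
    b_slides_by (t_id _) (t_id _) (t_id _) (t_id _) b_to_glue_l_top.
  + exists (inr (inl (inr (inl a)))).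
    b_slides_by (t_id _) (t_id _) (t_b_to _ _ _ _) (t_b_from _ _ _ _) b_to_glue_l.
  + exists (inl tt). b_slides_by (t_id _) (t_id _) (t_id _) (t_id _) b_to_glue_r_top.
  + exists (inr (inl (inr (inr b)))).
    b_slides_by (t_id _) (t_id _) (t_id _) (t_id _) b_to_glue_r_l.
  + exists (inr (inr c)).
    b_slides_by (t_b_to _ _ _ _) (t_b_from _ _ _ _) (t_id _) (t_id _) b_to_glue_r_r.
- destruct s as [[]|[[[]|[a|b]]|c]].
  + exists (inr (inr (inl tt))).
    b_slides_by (t_id _) (t_id _) (t_id _) (t_id _) b_to_glue_r_top.
  + exists (inl tt). b_slides_by (t_id _) (t_id _) (t_id _) (t_id _) b_to_glue_l_top.
  + exists (inr (inl a)).
    b_slides_by (t_id _) (t_id _) (t_b_to _ _ _ _) (t_b_from _ _ _ _) b_to_glue_l.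
  + exists (inr (inr (inr (inl b)))).
    b_slides_by (t_id _) (t_id _) (t_id _) (t_id _) b_to_glue_r_l.
  + exists (inr (inr (inr (inr c)))).
    b_slides_by (t_b_to _ _ _ _) (t_b_from _ _ _ _) (t_id _) (t_id _) b_to_glue_r_r.
- destruct s.
- destruct s as [[a b] c]. exists (a, (b, c)).
  b_slides_by (t_b_to _ _ _ _) (t_b_from _ _ _ _) (t_b_to _ _ _ _) (t_b_from _ _ _ _) b_to_glue_and.
- destruct s as [[]|[[[]|[a|b]]|c]].
  + exists (inr (inr (inl tt))).
    b_slides_by (t_id _) (t_id _) (t_id _) (t_id _) b_to_glue_r_top.
  + exists (inl tt). b_slides_by (t_id _) (t_id _) (t_id _) (t_id _) b_to_glue_l_top.
  + exists (inr (inl a)).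
    b_slides_by (t_id _) (t_id _) (t_b_to _ _ _ _) (t_b_from _ _ _ _) b_to_glue_l.
  + exists (inr (inr (inr (inl b)))).
    b_slides_by (t_id _) (t_id _) (t_id _) (t_id _) b_to_glue_r_l.
  + exists (inr (inr (inr (inr c)))).
    b_slides_by (t_b_to _ _ _ _) (t_b_from _ _ _ _) (t_id _) (t_id _) b_to_glue_r_r.
Qed.

(** Here it matters that a split of a conjunction along [Or] splits both conjuncts: a split of
    [A /\ B] then supplies one for each disjunction of the target. *)
Lemma ck_slides x A B C D (s : split x ((A /\ B) \/ (C /\ D))) :
  exists s', slides (t_ck A B C D) s s'.
Proof.
destruct x; [destruct s|]. destruct s as [[]|[[a b]|[c d]]].
- exists (inl tt, inl tt), (t_id _), (t_id _). simpl.
  rewrite te_bin_id, !te_id_r. apply ck_glue_top.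
- exists (inr (inl a), inr (inl b)), (t_id _), (t_ck _ _ _ _). apply ck_glue_l.
- exists (inr (inr c), inr (inr d)), (t_ck _ _ _ _), (t_id _). apply ck_glue_r.
Qed.

Lemma bin_slides x y A A' B B' (f : term A A') (g : term B B') :
  (forall s : split x A, exists s', slides f s s') ->
  (forall s : split x B, exists s', slides g s s') ->
  forall s : split x (Bin y A B), exists s', slides (t_bin y f g) s s'.
Proof.
intros Hf Hg s.
destruct x, y; [destruct s as [[]|[s|s]] | destruct s | | destruct s as [[]|[s|s]]].
(* When [x] and [y] agree, the split is at the top, in the left or in the right argument; the pair
   case sits between the two groups of three. Goals are renumbered after each selection. *)
1, 5: exists (inl tt), f, g; simpl; rewrite te_id_l, te_id_r; reflexivity.
1, 4: destruct (Hf s) as (s' & f1 & f2 & H);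
  exists (inr (inl s')), f1, (t_bin _ f2 g); exact (glue_l_natural g H).
1, 3: destruct (Hg s) as (s' & f1 & f2 & H);
  exists (inr (inr s')), (t_bin _ f f1), f2; exact (glue_r_natural f H).
- destruct s as [a b], (Hf a) as (a' & f1 & f2 & Ha), (Hg b) as (b' & g1 & g2 & Hb).
  exists (a', b'), (t_bin And f1 g1), (t_bin And f2 g2). exact (glue_and_natural Ha Hb).
Qed.

(** For the top split of a source [Bin x A1 A2] the gluing arrow is an identity, so this yields the
    factorisation of [f] through a gluing arrow. *)
Lemma term_slides x A B (f : term A B) :
  forall s : split x A, exists s', slides f s s'.
Proof.
induction f; intro s.
- exists s, (t_id _), (t_id _). rewrite te_bin_id, te_id_l, te_id_r. reflexivity.
- destruct (IHf2 s) as (s' & g1 & g2 & H), (IHf1 s') as (s'' & h1 & h2 & H').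
  exists s'', (h1 \o g1), (h2 \o g2).
  rewrite <- te_assoc, H, te_assoc, H', <- te_assoc, te_bin_comp. reflexivity.
- apply bin_slides; assumption.
- destruct (proj1 (b_slides_total x0 x A B C) s) as [s' H]. exists s'. apply H.
- destruct (proj2 (b_slides_total x0 x A B C) s) as [s' H]. exists s'. apply H.
- apply ck_slides.
Qed.

(** * Breadth and uniqueness of cuts *)

(* Letters left after replacing every disjunction by its first disjunct; both
sides of intermutation then count the letters of the first two arguments. *)
Fixpoint breadth (A : formula L) : nat :=
  match A with
  | Letter _ => 1
  | Bin And A B => breadth A + breadth B
  | Bin Or A _ => breadth A
  end.

Lemma breadth_pos A : 0 < breadth A.
Proof. induction A as [|[] A IHA B IHB]; simpl; lia. Qed.

Lemma breadth_term A B (f : term A B) : breadth A = breadth B.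
Proof. induction f; try destruct x; simpl in *; lia. Qed.

(** The letters that [breadth] counts all lie in the left part of any split along [Or]. *)
Lemma breadth_lft B (s : split Or B) : breadth (lft s) = breadth B.
Proof.
induction B as [|[] B1 IH1 B2 IH2]; simpl in *.
- destruct s.
- now rewrite IH1, IH2.
- destruct s as [[]|[s|s]]; simpl; auto.
Qed.

Lemma breadth_cut B (c : split And B) : breadth (lft c) < breadth B.
Proof.
induction B as [|[] B1 IH1 B2 IH2]; simpl in *; try destruct c.
- destruct u; simpl. pose proof (breadth_pos B2). lia.
- destruct s as [c|c]; simpl; [specialize (IH1 c)|specialize (IH2 c)]; lia.
Qed.

(** The cuts of a conjunction are linearly ordered, and the breadth of the left half grows strictly
    along this order. *)
Lemma cut_unique B (c c' : split And B) :
  breadth (lft c) = breadth (lft c') -> c = c'.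
Proof.
induction B as [|[] B1 IH1 B2 IH2]; simpl in *; try now destruct c.
destruct c as [[]|[c|c]], c' as [[]|[c'|c']]; simpl; intro H;
  try pose proof (breadth_cut c); try pose proof (breadth_cut c');
  try pose proof (breadth_pos (lft c)); try pose proof (breadth_pos (lft c'));
  try lia; repeat f_equal; auto.
apply IH2. lia.
Qed.

(** * Cuts of left parts *)

(* [None] stands for the degenerate split in which all of [B] is on the left. *)
Definition part (B : formula L) (o : option (split Or B)) : formula L :=
  match o with None => B | Some s => lft s end.

Lemma breadth_part B (o : option (split Or B)) : breadth (part o) = breadth B.
Proof. destruct o; [apply breadth_lft | reflexivity]. Qed.

(** The second copy of [B] keeps the right part nonempty, so that even the degenerate split becomes
    a genuine one, to which an induction hypothesis about splits applies. *)
Definition part_split (B : formula L) (o : option (split Or B)) : split Or (B \/ B) :=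
  match o with None => inl tt | Some s => inr (inl s) end.

Lemma lft_part_split B (o : option (split Or B)) : lft (part_split o) = part o.
Proof. now destruct o. Qed.

Lemma lft_pair A B (s : split Or A) (t : split Or B) :
  @lft Or (A /\ B) (s, t) = (lft s /\ lft t)%F.
Proof. reflexivity. Qed.

Lemma part_split_inj B (o o' : option (split Or B)) :
  part_split o = part_split o' -> o = o'.
Proof. destruct o, o'; simpl; congruence. Qed.

Definition meet_part B1 B2 (o : option (split Or (B1 /\ B2))) :
  (option (split Or B1) * option (split Or B2))%type :=
  match o with
  | None => (None, None)
  | Some (s1, s2) => (Some s1, Some s2)
  end.

Lemma meet_part_inj B1 B2 (o o' : option (split Or (B1 /\ B2))) :
  meet_part o = meet_part o' -> o = o'.
Proof. destruct o as [[]|], o' as [[]|]; simpl; congruence. Qed.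

Lemma part_meet B1 B2 (o : option (split Or (B1 /\ B2))) :
  part o = (part (fst (meet_part o)) /\ part (snd (meet_part o)))%F.
Proof. now destruct o as [[]|]. Qed.

Definition cut_of A (P Q : formula L) : Prop :=
  exists c : split And A, lft c = P /\ rgt c = Q.

Lemma cut_of_or A B P Q : ~ cut_of (A \/ B) P Q.
Proof. now intros [[] _]. Qed.

Lemma cut_of_and A B P Q : cut_of (A /\ B) P Q ->
  (P = A /\ Q = B) \/
  (exists Q', cut_of A P Q' /\ Q = Bin And Q' B /\ breadth P < breadth A) \/
  (exists P', cut_of B P' Q /\ P = Bin And A P').
Proof.
intros [[[]|[c|c]] [<- <-]]; simpl; [now left|right; left|right; right].
- exists (rgt c). repeat split; [now exists c|]. apply breadth_cut.
- exists (lft c). split; [now exists c|reflexivity].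
Qed.

(* The formulae [P] and [Q] are common to [o] and [o'], although the connective
at which [part o] is cut need not be a connective of [B] separating it into
[P] and [Q]: pieces of [B] are padded by [part_split]. *)
Lemma parts_cut B (o o' : option (split Or B)) X Y X' Y' :
  cut_of (part o) X Y -> cut_of (part o') X' Y' -> breadth X = breadth X' ->
  exists P Q (p p' : split Or P) (q q' : split Or Q),
    (lft p = X /\ lft q = Y /\ lft p' = X' /\ lft q' = Y') /\
    (p = p' -> q = q' -> o = o').
Proof.
revert X Y X' Y'. induction B as [|[] B1 IH1 B2 IH2]; intros X Y X' Y'.
- now destruct o as [[]|]; intros [[] _].
- rewrite !part_meet. intros H H' E.
  pose proof (@meet_part_inj _ _ o o') as inj.
  destruct (meet_part o) as [o1 o2], (meet_part o') as [o1' o2']; simpl in *.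
  (* Both [part o1] and [part o1'] have the breadth of [B1]. The left half of a cut is narrower than
     this, equal or wider according to whether the cut is inside the first conjunct, at the top or
     inside the second, so only matching positions survive [lia]. *)
  pose proof (breadth_part o1) as Ho. pose proof (breadth_part o1') as Ho'.
  destruct (cut_of_and H) as [[-> ->]|[(Y1 & H1 & -> & HX)|(X2 & H2 & ->)]],
    (cut_of_and H') as [[-> ->]|[(Y1' & H1' & -> & HX')|(X2' & H2' & ->)]];
    simpl in E;
    try pose proof (breadth_pos X2); try pose proof (breadth_pos X2'); try lia.
  + exists (B1 \/ B1)%F, (B2 \/ B2)%F,
      (part_split o1), (part_split o1'), (part_split o2), (part_split o2').
    rewrite !lft_part_split. split; [easy|].
    intros E1%part_split_inj E2%part_split_inj. apply inj. congruence.
  + destruct (IH1 _ _ _ _ _ _ H1 H1' E) as (P & Q & p & p' & q & q' & (<- & <- & <- & <-) & K).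
    exists P, (Q /\ (B2 \/ B2))%F, p, p', (q, part_split o2), (q', part_split o2').
    rewrite !lft_pair, !lft_part_split. split; [easy|].
    intros E1 [= E2 E3%part_split_inj]. apply inj. rewrite E3. f_equal. auto.
  + assert (E' : breadth X2 = breadth X2') by lia.
    destruct (IH2 _ _ _ _ _ _ H2 H2' E') as (P & Q & p & p' & q & q' & (<- & <- & <- & <-) & K).
    exists ((B1 \/ B1) /\ P)%F, Q, (part_split o1, p), (part_split o1', p'), q, q'.
    rewrite !lft_pair, !lft_part_split. split; [easy|].
    intros [= E1%part_split_inj E3] E2. apply inj. rewrite E1. f_equal. auto.
- intros H H' E.
  (* A formula that has a cut is not a disjunction, so the left part lies within [B1]; when it is
     the whole of [B1], the recursive call needs the degenerate split [None]. *)
  assert (D : forall (o : option (split Or (B1 \/ B2))) X Y, cut_of (part o) X Y ->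
    exists o1, o = Some (match o1 with None => inl tt | Some s => inr (inl s) end)
      /\ cut_of (part o1) X Y).
  { clear. intros [[[]|[s|s]]|] X Y H; simpl in H.
    - now exists None.
    - now exists (Some s).
    - now apply cut_of_or in H.
    - now apply cut_of_or in H. }
  destruct (D _ _ _ H) as (o1 & -> & H1), (D _ _ _ H') as (o1' & -> & H1').
  destruct (IH1 _ _ _ _ _ _ H1 H1' E) as (P & Q & p & p' & q & q' & K1 & K2).
  exists P, Q, p, p', q, q'. split; [exact K1|].
  intros E1 E2. now rewrite (K2 E1 E2).
Qed.

(** * Regrouping of nested splits *)

(* From the ternary labelling 1 | 2, 3 refined to 1 | 2 | 3, the split 1, 2 | 3. *)
Fixpoint regroup B : forall u : split Or B, split Or (rgt u) -> split Or B :=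
  match B return forall u : split Or B, split Or (rgt u) -> split Or B with
  | Letter _ => fun u => match u with end
  | Bin Or B1 B2 => fun u =>
      match u return split Or (@rgt Or (B1 \/ B2) u) -> split Or (B1 \/ B2) with
      | inl _ => fun r => inr (inr r)
      | inr (inl u1) => fun r =>
          match r with
          | inl _ => inl tt
          | inr (inl r1) => inr (inl (@regroup B1 u1 r1))
          | inr (inr r2) => inr (inr r2)
          end
      | inr (inr u2) => fun r => inr (inr (@regroup B2 u2 r))
      end
  | Bin And B1 B2 => fun u r =>
      (@regroup B1 (fst u) (fst r), @regroup B2 (snd u) (snd r))
  end.

Lemma regroup_exists B (s : split Or B) (t : split Or (lft s)) :
  exists (u : split Or B) (r : split Or (rgt u)),
    lft u = lft t /\ lft r = rgt t /\ s = regroup r.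
Proof.
induction B as [|[] B1 IH1 B2 IH2].
- destruct s.
- destruct s as [s1 s2], t as [t1 t2].
  destruct (IH1 s1 t1) as (u1 & r1 & E1 & F1 & G1), (IH2 s2 t2) as (u2 & r2 & E2 & F2 & G2).
  exists (u1, u2), (r1, r2). simpl. rewrite E1, E2, F1, F2.
  repeat split. exact (f_equal2 pair G1 G2).
- destruct s as [[]|[s|s]].
  + exists (inr (inl t)), (inl tt). easy.
  + destruct (IH1 s t) as (u & r & E & F & ->).
    exists (inr (inl u)), (inr (inl r)). easy.
  + destruct t as [[]|[t|t]].
    * exists (inl tt), s. easy.
    * exists (inr (inl t)), (inr (inr s)). easy.
    * destruct (IH2 s t) as (u & r & E & F & ->).
      exists (inr (inr u)), r. simpl. now rewrite E.
Qed.

(** * Uniqueness of splits and of arrows *)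

(** Only identities and their composites start at a letter. The [match] on the source keeps the
    indices of [f] general for the induction. *)
Lemma letter_term A B (f : term A B) :
  match A return term A B -> Prop with
  | Letter a => fun f =>
      exists e : Letter a = B, f == match e with eq_refl => t_id _ end
  | Bin _ _ _ => fun _ => True
  end f.
Proof.
induction f; try exact I.
- destruct A; [|exact I]. now exists eq_refl.
- destruct A; [|exact I]. destruct IHf2 as [e H]. destruct e.
  destruct IHf1 as [e' H']. exists e'. rewrite H, te_id_r. exact H'.
Qed.

(** A left part that is a single letter is reached by descending through first disjuncts, and the
    split falls right behind that letter. *)
Lemma lft_letter_unique a B (s s' : split Or B) :
  Letter a = lft s -> Letter a = lft s' -> s = s'.
Proof.
induction B as [|[] B1 IH1 B2 IH2].
- destruct s.
- discriminate.
- destruct s as [[]|[s|s]], s' as [[]|[s'|s']]; simpl; try discriminate.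
  + easy.
  + intros <-. destruct s'.
  + intros H <-. destruct s.
  + intros H H'. now rewrite (IH1 _ _ H H').
Qed.

Lemma split_unique A : forall B (s s' : split Or B),
  term A (lft s) -> term A (lft s') -> s = s'.
Proof.
induction A as [a|[] A1 IH1 A2 IH2]; intros B s s' f f'.
- destruct (letter_term f) as [e _], (letter_term f') as [e' _].
  exact (lft_letter_unique e e').
- destruct (term_slides f (inl tt : split And (A1 /\ A2))) as (c & f1 & f2 & _),
    (term_slides f' (inl tt : split And (A1 /\ A2))) as (c' & f1' & f2' & _).
  simpl in *.
  assert (E : breadth (lft c) = breadth (lft c'))
    by now rewrite <- (breadth_term f1), <- (breadth_term f1').
  destruct (@parts_cut B (Some s) (Some s') (lft c) (rgt c) (lft c') (rgt c'))
    as (P & Q & p & p' & q & q' & (Hp & Hq & Hp' & Hq') & K);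
    [now exists c | now exists c' | exact E |].
  rewrite <- Hp in f1. rewrite <- Hp' in f1'. rewrite <- Hq in f2. rewrite <- Hq' in f2'.
  assert (Some s = Some s') by (apply K; [now apply IH1 | now apply IH2]). congruence.
- destruct (term_slides f (inl tt : split Or (A1 \/ A2))) as (t & f1 & f2 & _),
    (term_slides f' (inl tt : split Or (A1 \/ A2))) as (t' & f1' & f2' & _).
  simpl in *.
  (* The splits [t] and [t'] live in different formulae and cannot be compared. After regrouping,
     [u] and [u'] both split [B]; once they are identified, [r] and [r'] both split [rgt u]. *)
  destruct (regroup_exists t) as (u & r & Hu & Hr & ->),
    (regroup_exists t') as (u' & r' & Hu' & Hr' & ->).
  rewrite <- Hu in f1. rewrite <- Hu' in f1'. rewrite <- Hr in f2. rewrite <- Hr' in f2'.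
  destruct (IH1 B u u' f1 f1'). now destruct (IH2 _ r r' f2 f2').
Qed.

Lemma term_eq_all A : forall B (f g : term A B), f == g.
Proof.
induction A as [a|x A1 IH1 A2 IH2]; intros B f g.
- destruct (letter_term f) as [e ->], (letter_term g) as [e' ->].
  (* Letters form an arbitrary type, so equality proofs between formulae are identified by proof
     irrelevance. *)
  now rewrite (proof_irrelevance _ e e').
- assert (D : forall h : term (Bin x A1 A2) B, exists (s : split x B)
      (h1 : term A1 (lft s)) (h2 : term A2 (rgt s)), h == glue s \o t_bin x h1 h2).
  { intro h. destruct x;
      [ destruct (term_slides h (inl tt : split And (A1 /\ A2))) as (s & h1 & h2 & H)
      | destruct (term_slides h (inl tt : split Or (A1 \/ A2))) as (s & h1 & h2 & H) ];
      exists s, h1, h2; rewrite <- H; simpl; symmetry; apply te_id_r. }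
  destruct (D f) as (s & f1 & f2 & ->), (D g) as (s' & g1 & g2 & ->).
  assert (E : s = s').
  { destruct x.
    - apply cut_unique. now rewrite <- (breadth_term f1), <- (breadth_term g1).
    - exact (split_unique f1 g1). }
  destruct E. now rewrite (IH1 _ f1 g1), (IH2 _ f2 g2).
Qed.

End Calculus.

Theorem mainTheorem2 (L : Type) : is_preorder (ACk L).
Proof.
intros A B a b. simpl in *.
destruct (cls_surj a) as [f ->], (cls_surj b) as [g ->].
apply cls_eq, term_eq_all.
Qed.
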